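(* $m(n,R)=\min\{m(n,R_i/M_i): i\in[\ell]\}$.
   Context: $R$ is a finite commutative ring with identity $1\neq0$, written as $R=R_1\times\cdots\times R_\ell$ with $R_i$ finite local rings with maximal ideals $M_i$, so $R_i/M_i$ are finite fields. For a commutative ring $S$, a set of vectors in $S^n$ is unimodular if the matrix having them as rows has a right inverse; an $m$-subspace of $S^n$ is a submodule with a basis of $m$ vectors forming a unimodular set; points are $1$-subspaces. A $k$-arc in $S^n$ is a set of $k$ points such that any $n$ of them span the whole space $S^n$ (arcs are assumed to have size at least $n+1$). $m(n,S)$ denotes the maximum number of points of an arc in $S^n$. *)

(* Defs.v *)
From HB Require Import structures.
From mathcomp Require Import all_boot all_algebra.
From mathcomp Require Import generic_quotient ring_quotient.

Set Implicit Arguments.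
Unset Strict Implicit.
Unset Printing Implicit Defensive.

Import GRing.Theory.
Local Open Scope ring_scope.

Section FiniteQuotient.
Variables (R : finComNzRingType) (J : idealr R).

(* The library's quotient ring R / J, with its missing finiteness instance. *)
Definition quotient_ring := {ideal_quot J}.

HB.instance Definition _ := GRing.ComNzRing.on quotient_ring.
HB.instance Definition _ : isCountable quotient_ring :=
  CanIsCountable (@reprK _ {ideal_quot J}).
HB.instance Definition _ : isFinite quotient_ring :=
  CanIsFinite (@reprK _ {ideal_quot J}).

End FiniteQuotient.

Section LocalRing.
Variable R : comNzRingType.

(* An [idealr] is proper by definition. *)
Definition maximal_ideal (M : idealr R) : Prop :=
  forall J : idealr R, {subset M <= J} -> {subset J <= M}.

Definition local_ring (M : idealr R) : Prop :=
  maximal_ideal M /\ forall M' : idealr R, maximal_ideal M' -> M' =i M.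

End LocalRing.

Section ProductRing.
Variables (I : finType) (Rs : I -> comNzRingType).

Definition prod_ring := {dffun forall i, Rs i}.

HB.instance Definition _ := Choice.on prod_ring.

Definition prod_zero : prod_ring := [ffun i => 0].
Definition prod_one : prod_ring := [ffun i => 1].
Definition prod_opp (f : prod_ring) : prod_ring := [ffun i => - f i].
Definition prod_add (f g : prod_ring) : prod_ring := [ffun i => f i + g i].
Definition prod_mul (f g : prod_ring) : prod_ring := [ffun i => f i * g i].

Fact prod_addA : associative prod_add.
Proof. by move=> f g h; apply/ffunP => i; rewrite !ffunE addrA. Qed.
Fact prod_addC : commutative prod_add.
Proof. by move=> f g; apply/ffunP => i; rewrite !ffunE addrC. Qed.
Fact prod_add0 : left_id prod_zero prod_add.
Proof. by move=> f; apply/ffunP => i; rewrite !ffunE add0r. Qed.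
Fact prod_addN : left_inverse prod_zero prod_opp prod_add.
Proof. by move=> f; apply/ffunP => i; rewrite !ffunE addNr. Qed.
Fact prod_mulA : associative prod_mul.
Proof. by move=> f g h; apply/ffunP => i; rewrite !ffunE mulrA. Qed.
Fact prod_mulC : commutative prod_mul.
Proof. by move=> f g; apply/ffunP => i; rewrite !ffunE mulrC. Qed.
Fact prod_mul1 : left_id prod_one prod_mul.
Proof. by move=> f; apply/ffunP => i; rewrite !ffunE mul1r. Qed.
Fact prod_mulDl : left_distributive prod_mul prod_add.
Proof. by move=> f g h; apply/ffunP => i; rewrite !ffunE mulrDl. Qed.

HB.instance Definition _ :=
  GRing.isZmodule.Build prod_ring prod_addA prod_addC prod_add0 prod_addN.
HB.instance Definition _ :=
  GRing.Zmodule_isComPzRing.Build prod_ring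
    prod_mulA prod_mulC prod_mul1 prod_mulDl.

End ProductRing.

Section Arcs.
Variables (S : finComNzRingType) (n : nat).

Definition unimodular m (A : 'M[S]_(m, n)) : bool :=
  [exists B : 'M[S]_(n, m), A *m B == 1%:M].

Definition lin_indep m (A : 'M[S]_(m, n)) : bool :=
  [forall c : 'rV[S]_m, (c *m A == 0) ==> (c == 0)].

Definition span_rows m (A : 'M[S]_(m, n)) : {set 'rV[S]_n} :=
  [set c *m A | c : 'rV[S]_m].

(* Vectors are rows; the rows of [A] are a unimodular basis of the
   submodule [W]. *)
Definition subspace m (W : {set 'rV[S]_n}) : bool :=
  [exists A : 'M[S]_(m, n),
    [&& unimodular A, lin_indep A & W == span_rows A]].

Definition point (W : {set 'rV[S]_n}) : bool := subspace 1 W.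

Definition span_set (X : {set 'rV[S]_n}) : {set 'rV[S]_n} :=
  [set \sum_(x in X) c x *: x | c : {ffun 'rV[S]_n -> S}].

Definition arc (K : {set {set 'rV[S]_n}}) : bool :=
  [&& n < #|K|,
      [forall W in K, point W]
    & [forall B : {set {set 'rV[S]_n}},
        (B \subset K) && (#|B| == n) ==> (span_set (cover B) == setT)]]%N.

End Arcs.

(* For n <= 1 there is no arc and the value is 0; for n >= 2 the frame formed
   by the standard basis and the all-one vector is an arc. *)
Definition max_arc (n : nat) (S : finComNzRingType) : nat :=
  (\max_(K : {set {set 'rV[S]_n}} | arc K) #|K|)%N.

(* Main.v *)
Require Import Defs.
From HB Require Import structures.
From mathcomp Require Import all_boot all_algebra.
From mathcomp Require Import generic_quotient ring_quotient.
From mathcomp Require Import perm.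

Set Implicit Arguments.
Unset Strict Implicit.
Unset Printing Implicit Defensive.

(** For n >= 2, picking generators of the points identifies arcs of size k > n
    in S^n with k x n matrices over S all of whose n x n minors are invertible
    (for n <= 1 there are no arcs).  Ring morphisms preserve invertible minors,
    so an arc over R yields one of the same size over each R_i / M_i.
    Conversely, an element of R is invertible as soon as its images in all the
    R_i / M_i are, because a non-invertible element of a finite local ring lies
    in the maximal ideal; hence matrices over the residue fields, lifted entry
    by entry, glue to a matrix over R with invertible minors. *)

Import GRing.Theory.
Local Open Scope ring_scope.

(** * Matrices with invertible maximal minors *)

Definition invertible (S : comNzRingType) (x : S) : Prop :=
  exists y, x * y = 1.

(** Ordered choices of rows stand for row sets: reordering changes a minor only by a sign. *)
Definition arc_mx (S : comNzRingType) k n (A : 'M[S]_(k, n)) : Prop :=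
  forall f : 'I_n -> 'I_k, injective f -> invertible (\det (rowsub f A)).

Lemma right_inverse_det (S : comNzRingType) n (A : 'M[S]_n) :
  invertible (\det A) <-> exists B, A *m B = 1%:M.
Proof.
split=> [[y dy] | [B AB]].
  by exists (y *: \adj A); rewrite -scalemxAr mul_mx_adj scale_scalar_mx mulrC dy.
by exists (\det B); rewrite -det_mulmx AB det1.
Qed.

Lemma invertible_rmorph (S T : comNzRingType) (h : {rmorphism S -> T}) x :
  invertible x -> invertible (h x).
Proof. by case=> y xy; exists (h y); rewrite -rmorphM xy rmorph1. Qed.

Lemma arc_mx_rmorph (S T : comNzRingType) (h : {rmorphism S -> T}) k n
    (A : 'M[S]_(k, n)) : arc_mx A -> arc_mx (map_mx h A).
Proof.
move=> arcA f /arcA /(invertible_rmorph h); rewrite -det_map_mx.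
by rewrite map_mxsub.
Qed.

Lemma arc_mx_rowsub (S : comNzRingType) k k' n (A : 'M[S]_(k, n))
    (g : 'I_k' -> 'I_k) : injective g -> arc_mx A -> arc_mx (rowsub g A).
Proof.
move=> injg arcA f injf; rewrite -rowsub_comp.
by apply: arcA; apply: inj_comp.
Qed.

(** Provides a maximal minor whose first two rows are prescribed. *)
Lemma exists_inj_ord2 n k (i j : 'I_k) : (n.+2 <= k)%N -> i != j ->
  exists2 f : 'I_n.+2 -> 'I_k, injective f & f ord0 = i /\ f (lift ord0 ord0) = j.
Proof.
move=> le_nk neq_ij.
pose w := widen_ord le_nk; pose a := w ord0; pose b := w (lift ord0 ord0).
(* The outer transposition sends [a] to [i]; [u] is the preimage of [j] under it, so sending [b] to
   [u] first makes [b] land on [j]. *)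
pose u := tperm a i j.
have neq_au : u != a.
  by rewrite /u -(inj_eq (@perm_inj _ (tperm a i))) tpermK tpermL eq_sym.
exists (fun x => tperm a i (tperm b u (w x))).
  by move=> x y /perm_inj /perm_inj /(congr1 val) /= /val_inj.
rewrite -/a -/b tpermL /u tpermK; split=> //.
by rewrite (@tpermD _ b) ?tpermL.
Qed.

(** * Arcs and their generator matrices *)

Section ArcMatrix.
Variable S : finComNzRingType.

Lemma mem_span_rows n m (A : 'M[S]_(m, n)) v :
  reflect (exists c, v = c *m A) (v \in span_rows A).
Proof.
apply: (iffP imsetP) => [[c _ ->] | [c ->]]; first by exists c.
by exists c.
Qed.

(** The first column of the inverse of a minor through both rows is a linear form separating them;
    it shows that rows generate points and that these points are distinct. *)
Lemma arc_mx_row_pair n k (A : 'M[S]_(k, n.+2)) (i j : 'I_k) :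
    arc_mx A -> (n.+2 <= k)%N -> i != j ->
  exists2 b : 'cV[S]_n.+2, row i A *m b = 1%:M & row j A *m b = 0.
Proof.
move=> arcA le_nk /(exists_inj_ord2 le_nk) [f injf [fi fj]].
have /right_inverse_det [B AB] := arcA f injf.
have rowE x : row (f x) A *m col ord0 B = col ord0 (row x 1%:M).
  by rewrite -AB row_mul row_rowsub !colE mulmxA.
exists (col ord0 B); first by rewrite -fi rowE; apply/matrixP=> x y; rewrite !mxE !ord1.
by rewrite -fj rowE; apply/matrixP=> x y; rewrite !mxE.
Qed.

Lemma arc_of_mx n k (A : 'M[S]_(k, n.+2)) : arc_mx A -> (n.+2 < k)%N ->
  exists2 K : {set {set 'rV[S]_n.+2}}, Defs.arc K & #|K| = k.
Proof.
move=> arcA lt_nk; pose P i := span_rows (row i A).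
have le_nk := ltnW lt_nk.
have memP i : row i A \in P i.
  by apply/mem_span_rows; exists 1%:M; rewrite mul1mx.
have injP : injective P.
  (* If the spans agreed, row [i] would be a multiple of row [j], and applying [b] would give 1 =
     0. *)
  move=> i j eqPij; apply/eqP/negPn/negP => /(arc_mx_row_pair arcA le_nk) [b bi bj].
  have := memP i; rewrite eqPij => /mem_span_rows [c /(congr1 (mulmx^~ b))].
  rewrite bi -mulmxA bj mulmx0 => /matrixP /(_ 0 0) /eqP.
  by rewrite !mxE oner_eq0.
have cardK : #|[set P i | i in 'I_k]| = k by rewrite card_imset ?card_ord.
exists [set P i | i in 'I_k] => //; apply/and3P; split; first by rewrite cardK.
  apply/forall_inP => _ /imsetP [i _ ->].
  (* Any second index yields a right inverse [b] of row [i], whence unimodularity and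
     independence. *)
  have [j neq_ij] : exists j, i != j.
    have k_gt1 : (1 < k)%N by apply: leq_trans le_nk.
    have k_gt0 := ltnW k_gt1.
    case: (eqVneq i (Ordinal k_gt0)) => [-> | ?]; last by exists (Ordinal k_gt0).
    by exists (Ordinal k_gt1).
  have [b bi _] := arc_mx_row_pair arcA le_nk neq_ij.
  apply/existsP; exists (row i A); apply/and3P; split=> //.
    by apply/existsP; exists b; rewrite bi.
  apply/forallP => c; apply/implyP => /eqP cA0.
  by rewrite -[c]mulmx1 -bi mulmxA cA0 mul0mx.
apply/forallP => B; apply/implyP => /andP [sBK /eqP cardB].
pose W j := enum_val (cast_ord (esym cardB) j).
have memW j : W j \in B by apply: enum_valP.
have /fin_all_exists [f fP] j : exists i, W j = P i.
  by have /imsetP [i _ ->] := subsetP sBK _ (memW j); exists i.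
have injf : injective f.
  by move=> j j' eqf; apply/(@cast_ord_inj _ _ (esym cardB))/enum_val_inj;
     rewrite -!/(W _) !fP eqf.
have /right_inverse_det [C /mulmx1C CA] := arcA f injf.
rewrite eqEsubset subsetT; apply/subsetP => v _.
pose d := v *m C.
(* [span_set] wants a coefficient for every vector of the cover: coordinates are grouped by row, and
   vectors that are not chosen rows get the empty sum 0. *)
apply/imsetP; exists [ffun x => \sum_(j | row (f j) A == x) d 0 j] => //.
rewrite -[v]mulmx1 -CA mulmxA -/d mulmx_sum_row.
rewrite (partition_big (fun j => row (f j) A) (mem (cover B))) => [|j _] /=.
  apply: eq_bigr => x _; rewrite ffunE scaler_suml.
  by apply: eq_bigr => j /eqP <-; rewrite row_rowsub.
by apply/bigcupP; exists (W j); rewrite // fP.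
Qed.

Lemma span_set_submodule n (X : {set 'rV[S]_n}) m (A : 'M[S]_(m, n)) :
  {in X, forall x, exists c, x = c *m A} ->
  {in span_set X, forall v, exists c, v = c *m A}.
Proof.
move=> XA _ /imsetP [c _ ->]; apply: (big_ind (fun v => exists c, v = c *m A)).
- by exists 0; rewrite mul0mx.
- by move=> _ _ [a ->] [b ->]; exists (a + b); rewrite mulmxDl.
- by move=> x /XA [a ->]; exists (c (a *m A) *: a); rewrite scalemxAl.
Qed.

(** Since [n] of the points span, the standard basis vectors are combinations of the chosen
    generators; the coefficients form a left inverse, which over a commutative ring is also a right
    inverse. *)
Lemma mx_of_arc n (K : {set {set 'rV[S]_n}}) :
  Defs.arc K -> exists A : 'M[S]_(#|K|, n), arc_mx A.
Proof.
case/and3P => _ /forall_inP pointK /forallP spanK.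
have /fin_all_exists [a aP] (i : 'I_#|K|) : exists a : 'rV[S]_n, enum_val i = span_rows a.
  by have /existsP [a /and3P [_ _ /eqP]] := pointK _ (enum_valP i); exists a.
exists (\matrix_i a i) => f injf; apply/right_inverse_det.
have injW : injective (fun j => enum_val (f j) : {set 'rV[S]_n}).
  by move=> i j /enum_val_inj /injf.
pose B := [set enum_val (f j) | j : 'I_n].
have sBK : B \subset K.
  by apply/subsetP => _ /imsetP [j _ ->]; apply: enum_valP.
have := spanK B; rewrite sBK card_imset // card_ord eqxx /= => /eqP spanT.
have rowP (v : 'rV[S]_n) : exists c, v = c *m rowsub f (\matrix_i a i).
  have: v \in [set: 'rV[S]_n] by rewrite inE.
  rewrite -spanT; apply: span_set_submodule => x.
  case/bigcupP => _ /imsetP [j _ ->]; rewrite aP => /mem_span_rows [c ->].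
  exists (c *m delta_mx 0 j).
  by rewrite -mulmxA -rowE row_rowsub rowK.
have /fin_all_exists [c cP] (i : 'I_n) := rowP (delta_mx 0 i).
exists (\matrix_i c i); apply: mulmx1C; apply/row_matrixP => i.
by rewrite row_mul rowK -cP row1.
Qed.

Lemma max_arc_attained n : (0 < max_arc n S)%N ->
  exists2 K : {set {set 'rV[S]_n}}, Defs.arc K & #|K| = max_arc n S.
Proof.
rewrite /max_arc => max_gt0.
have [K arcK | noarc] := pickP (@Defs.arc S n); last by rewrite big_pred0 in max_gt0.
have [|K' arcK' ->] := @eq_bigmax_cond _ (@Defs.arc S n) (fun K => #|K|).
  by apply/card_gt0P; exists K.
by exists K'.
Qed.

Lemma max_arc_gt n : (0 < max_arc n S)%N -> (n < max_arc n S)%N.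
Proof. by case/max_arc_attained => K /and3P [ltK _ _] <-. Qed.

(** For [n = 0] a unimodular row would factor the identity through a zero module; for [n = 1] such a
    row is a unit, so the whole module is the only point. *)
Lemma max_arc_small n : (n <= 1)%N -> max_arc n S = 0%N.
Proof.
move=> le_n1; apply/eqP; rewrite -leqn0 leqNgt; apply/negP.
case/max_arc_attained => K /and3P [ltK /forall_inP pointK _] _.
suff: (#|K| <= n)%N by rewrite leqNgt ltK.
case: n le_n1 K ltK pointK => [|[|//]] _ K ltK pointK.
  have /card_gt0P [W /pointK] := ltK.
  case/existsP => A /and3P [/existsP [B /eqP]].
  rewrite thinmx0 mul0mx => /matrixP /(_ 0 0) /eqP.
  by rewrite !mxE eq_sym oner_eq0.
suff /subset_leq_card : K \subset [set setT] by rewrite cards1.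
apply/subsetP => W /pointK /existsP [A /and3P [/existsP [B /eqP /mulmx1C BA]] _].
move=> /eqP ->; rewrite inE eqEsubset subsetT; apply/subsetP => v _.
by apply/mem_span_rows; exists (v *m B); rewrite -mulmxA BA mulmx1.
Qed.

(** Deleting rows keeps the minors invertible, so every size between [n.+3] and the maximum is
    attained. *)
Lemma leq_max_arcP n k : (n.+2 < k)%N ->
  (k <= max_arc n.+2 S)%N <-> exists A : 'M[S]_(k, n.+2), arc_mx A.
Proof.
move=> lt_nk; split=> [le_k | [A arcA]].
  have [|K /mx_of_arc [A arcA] cardK] := @max_arc_attained n.+2.
    by apply: leq_trans le_k; apply: leq_trans lt_nk.
  rewrite -cardK in le_k; exists (rowsub (widen_ord le_k) A).
  by apply: arc_mx_rowsub arcA => i j /(congr1 val) /= /val_inj.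
have [K arcK <-] := arc_of_mx arcA lt_nk.
exact: (leq_bigmax_cond (F := fun K : {set _} => #|K|)).
Qed.

End ArcMatrix.

Lemma max_arc_rmorph (S T : finComNzRingType) (h : {rmorphism S -> T}) n :
  (max_arc n S <= max_arc n T)%N.
Proof.
case: n => [|[|n]]; [by rewrite max_arc_small | by rewrite max_arc_small |].
have [-> // | /max_arc_gt lt_nk] := posnP (max_arc n.+2 S).
have /(leq_max_arcP _ lt_nk) [A arcA] := leqnn (max_arc n.+2 S).
by apply/(leq_max_arcP _ lt_nk); exists (map_mx h A); apply: arc_mx_rmorph.
Qed.

(** * Maximal ideals and units of finite rings *)

Section FiniteIdeal.
Variable S : finComNzRingType.

(** Boolean on finite sets, so that a maximal proper ideal can be found with [maxset_exists]. *)
Definition is_idealr (J : {set S}) : bool :=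
  [&& 0 \in J, 1 \notin J
    & [forall a, forall u in J, forall v in J, a * u + v \in J]].

Lemma is_idealrP (J : {set S}) : reflect (idealr_closed (mem J)) (is_idealr J).
Proof.
apply: (iffP and3P) => [[J0 J1 /forallP JD] | [J0 J1 JD]]; split=> //.
  by move=> a u v uJ vJ; have /forall_inP /(_ u uJ) /forall_inP := JD a; apply.
apply/forallP => a; apply/forall_inP => u uJ; apply/forall_inP => v vJ.
exact: JD.
Qed.

Lemma idealr_of_set (J : {set S}) :
  is_idealr J -> exists J' : idealr S, J' =i J.
Proof.
move/is_idealrP => idJ.
pose inst := isIdealr.Build S (mem J) idJ.
pose J' : idealr S := HB.pack (mem J : S -> bool) inst.
by exists J'.
Qed.

(** The principal ideal of a non-unit is proper, and finiteness extends it to a maximal one. *)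
Lemma noninvertible_maximal (x : S) : ~ invertible x ->
  exists2 M : idealr S, maximal_ideal M & x \in M.
Proof.
move=> nx.
have idx : is_idealr [set x * y | y : S].
  apply/is_idealrP; split=> /=.
  - by apply/imsetP; exists 0; rewrite ?mulr0.
  - by apply/imsetP => -[y _ xy]; case: nx; exists y.
  - move=> a _ _ /imsetP [y _ ->] /imsetP [z _ ->]; apply/imsetP.
    by exists (a * y + z); rewrite // mulrDr mulrCA.
have [J /maxsetP [idJ maxJ] sxJ] := maxset_exists idx.
have [M eqM] := idealr_of_set idJ.
exists M; last first.
  by rewrite eqM (subsetP sxJ) //; apply/imsetP; exists 1; rewrite ?mulr1.
move=> I sMI u uI; rewrite eqM.
rewrite -(maxJ [set v in I]) ?inE //; last first.
  by apply/subsetP => v; rewrite -eqM inE => /sMI.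
apply/is_idealrP; split=> [||a v w]; rewrite !inE ?rpred0 ?idealr1 //.
by move=> vI wI; rewrite rpredD ?idealMr.
Qed.

Lemma local_invertible (M : idealr S) (x : S) :
  local_ring M -> x \notin M -> invertible x.
Proof.
case=> _ uniqM xM.
have [/existsP [y /eqP] | nx] := boolP [exists y, x * y == 1]; first by exists y.
have [|M' maxM' xM'] := @noninvertible_maximal x.
  by case=> y xy; case/existsP: nx; exists y; rewrite xy.
by rewrite -(uniqM _ maxM') xM' in xM.
Qed.

Definition residue (M : idealr S) : {rmorphism S -> quotient_ring M} :=
  (\pi_{ideal_quot M})%qT.

Lemma residue_invertible (M : idealr S) (x : S) :
  local_ring M -> invertible (residue M x) -> invertible x.
Proof.
move=> locM [y xy]; apply: (local_invertible locM); apply/negP => xM.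
have: residue M x = 0.
  by apply/eqP; rewrite -[0](rmorph0 (residue M)) -Quotient.idealrBE subr0.
move=> x0; move: xy; rewrite x0 mul0r => /eqP.
by rewrite eq_sym oner_eq0.
Qed.

End FiniteIdeal.

(** * Gluing along the product decomposition *)

Section Component.
Variables (I : finType) (R : finComNzRingType) (Rs : I -> finComNzRingType).
Variable phi : {rmorphism R -> prod_ring Rs}.

Definition component (i : I) (x : R) : Rs i := phi x i.

Fact component_is_zmod_morphism i : zmod_morphism (component i).
Proof. by move=> x y; rewrite /component rmorphB !ffunE. Qed.

Fact component_is_monoid_morphism i : monoid_morphism (component i).
Proof.
by split=> [|x y]; rewrite /component ?rmorph1 ?rmorphM ffunE.
Qed.

HB.instance Definition _ i := GRing.isZmodMorphism.Build R (Rs i)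
  (component i) (component_is_zmod_morphism i).
HB.instance Definition _ i := GRing.isMonoidMorphism.Build R (Rs i)
  (component i) (component_is_monoid_morphism i).

Lemma component_surjective (z : forall i, Rs i) :
  bijective phi -> exists x, forall i, component i x = z i.
Proof.
case=> psi _ psiK; exists (psi [ffun i => z i]) => i.
by rewrite /component psiK ffunE.
Qed.

Lemma component_invertible x : bijective phi ->
  (forall i, invertible (component i x)) -> invertible x.
Proof.
move=> bij_phi /fin_all_exists [z zP].
have [y yP] := component_surjective z bij_phi.
exists y; apply: (bij_inj bij_phi); apply/ffunP => i.
by rewrite rmorphM rmorph1 !ffunE -zP -yP.
Qed.

Lemma arc_mx_lift (M : forall i, idealr (Rs i)) k n
    (A : forall i, 'M[quotient_ring (M i)]_(k, n)) :
    bijective phi -> (forall i, local_ring (M i)) ->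
  (forall i, arc_mx (A i)) -> exists B : 'M[R]_(k, n), arc_mx B.
Proof.
move=> bij_phi locM arcA.
have entry a b : exists x, forall i, residue (M i) (component i x) = A i a b.
  (* Arbitrary representatives suffice: only residues of minors decide invertibility. *)
  have [x xP] := component_surjective (fun i => repr (A i a b)) bij_phi.
  by exists x => i; rewrite xP; apply: reprK.
have /fin_all_exists [g gP] (ab : 'I_k * 'I_n) := entry ab.1 ab.2.
exists (\matrix_(a, b) g (a, b)) => f injf.
apply: component_invertible => // i; apply: residue_invertible (locM i) _.
rewrite -det_map_mx -det_map_mx.
suff -> : map_mx (residue (M i)) (map_mx (component i)
    (rowsub f (\matrix_(a, b) g (a, b)))) = rowsub f (A i) by apply: arcA.
by apply/matrixP => a b; rewrite !mxE gP.
Qed.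

End Component.

(** * The minimum over the residue fields *)

Lemma leq_bigminn (J : Type) (r : seq J) (F : J -> nat) m x :
  (m <= \big[minn/x]_(j <- r) F j)%N = (m <= x)%N && all (fun j => (m <= F j)%N) r.
Proof.
elim: r => [|j r IHr]; first by rewrite big_nil andbT.
by rewrite big_cons leq_min IHr /= andbCA.
Qed.

Theorem theorem6p2 (n l : nat) (R : finComNzRingType)
    (Rs : 'I_l.+1 -> finComNzRingType) (M : forall i, idealr (Rs i))
    (phi : {rmorphism R -> prod_ring Rs}) :
  bijective phi ->
  (forall i, local_ring (M i)) ->
  max_arc n R =
    \big[minn/max_arc n (quotient_ring (M ord0))]_(i < l.+1)
      max_arc n (quotient_ring (M i)).
Proof.
move=> bij_phi locM.
have le_quot i : (max_arc n R <= max_arc n (quotient_ring (M i)))%N.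
  pose h : {rmorphism R -> quotient_ring (M i)} :=
    residue (M i) \o component phi i.
  exact: (max_arc_rmorph h).
(* The default value of the minimum is its [ord0] term, so [le_quot] bounds it too. *)
apply/eqP; rewrite eqn_leq leq_bigminn le_quot /=; apply/andP; split.
  by apply/allP => i _.
set k := (X in (X <= _)%N).
have k_le i : (k <= max_arc n (quotient_ring (M i)))%N.
  have := leqnn k; rewrite {2}/k leq_bigminn => /andP [_ /allP]; apply.
  exact: mem_index_enum.
have [-> // | k_gt0] := posnP k.
(* Every term is at least [k], hence positive, hence attained by an arc with more than [n]
   points. *)
have lt_nk : (n < k)%N.
  rewrite leq_bigminn; apply/andP; split; last apply/allP => i _;
    exact: max_arc_gt (leq_trans k_gt0 (k_le _)).
case: n {le_quot} @k k_le k_gt0 lt_nk => [|[|n]] k k_le k_gt0 lt_nk.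
- by have := k_le ord0; rewrite max_arc_small // leqNgt k_gt0.
- by have := k_le ord0; rewrite max_arc_small // leqNgt k_gt0.
have /fin_all_exists [A arcA] i := (leq_max_arcP _ lt_nk).1 (k_le i).
by apply/(leq_max_arcP _ lt_nk); apply: arc_mx_lift bij_phi locM arcA.
Qed.
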